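(* For all integers $k\ge3$ and $n\ge2$, $$\widehat{\mathrm{ex}}(n,C_{+2k})\ \le\ 2(k-1)n^{1+1/k}+8(k-1)n+2(k-1)n^{1-1/k}.$$
   Context: All graphs are finite and simple. A signed graph is a pair $\widehat G=(G,\sigma)$ with underlying graph $G$ and $\sigma:E(G)\to\{+1,-1\}$. The sign of a cycle is the product of its edge signs; a cycle is balanced if its sign is $+1$. A signed graph is $C_{+2k}$-free if it contains no balanced cycle of length $2k$. $\widehat{\mathrm{ex}}(n,C_{+2k})$ is the maximum number of edges of an $n$-vertex $C_{+2k}$-free signed graph. *)

(* Defs.v *)
From HB Require Import structures.
From mathcomp Require Import all_boot all_order all_algebra.

Set Implicit Arguments.
Unset Strict Implicit.
Unset Printing Implicit Defensive.

Import GRing.Theory.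

Local Open Scope ring_scope.

Section SignedGraphs.

Variable V : finType.

(* Edges are unordered pairs, that is, two-element sets of vertices. *)
Record simple_graph : predArgType := SimpleGraph {
  edge_set : {set {set V}};
  _ : [forall e in edge_set, #|e| == 2%N]
}.

HB.instance Definition _ := [isSub for edge_set].
HB.instance Definition _ := [Finite of simple_graph by <:].

Definition edge (G : simple_graph) : finType := {e : {set V} | e \in edge_set G}.

(* The signature takes values in bool so that signed graphs form a finType;
   b stands for the sign (-1) ^+ b, so false is +1 and true is -1. *)
Definition signed_graph : finType := {G : simple_graph & {ffun edge G -> bool}}.

Definition underlying (S : signed_graph) : simple_graph := tag S.

Definition signature (S : signed_graph) : {ffun edge (underlying S) -> bool} :=
  tagged S.

Definition adj (G : simple_graph) : rel V :=
  [rel x y | [set x; y] \in edge_set G].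

(* The default value 1 on non-edges is never used on a cycle of the graph. *)
Definition edge_sign (S : signed_graph) (x y : V) : int :=
  if insub [set x; y] is Some e then (-1) ^+ signature S e else 1.

(* Cycles are given by their cyclic sequences of pairwise distinct vertices. *)
Definition is_cycle (G : simple_graph) (c : seq V) : bool :=
  (3 <= size c)%N && ucycleb (adj G) c.

Definition cycle_sign (S : signed_graph) (c : seq V) : int :=
  \prod_(x <- c) edge_sign S x (next c x).

Definition balanced (S : signed_graph) (c : seq V) : bool :=
  cycle_sign S c == 1.

Definition balanced_cycle_free (l : nat) (S : signed_graph) : bool :=
  ~~ [exists c : l.-tuple V, is_cycle (underlying S) c && balanced S c].

End SignedGraphs.

Definition signed_ex (n l : nat) : nat :=
  \max_(S : signed_graph 'I_n | balanced_cycle_free l S)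
    #|edge_set (underlying S)|.

(* Main.v *)
Require Import Defs.
From mathcomp Require Import all_boot all_order all_algebra.
From mathcomp Require Import zify ring lra.
From mathcomp Require Import reals exp.
Set Implicit Arguments.
Unset Strict Implicit.
Unset Printing Implicit Defensive.
Import Order.TTheory GRing.Theory Num.Theory.

(* A graph with too many edges has a subgraph of minimum degree greater than
   t = 2(k-1)(q + 4 + 1/q), where q = n^(1/k).  Take its breadth-first layers
   V_0, V_1, ... and switch so that every tree edge is positive.  If the edges of
   one sign inside V_i, or between V_i and V_(i+1), contained a cycle with a chord
   on at least 2k-1 vertices, then a colouring argument would give two vertices of
   V_i whose tree paths first meet m levels up and which are joined by a path of
   2(k-m) edges of that sign; together with the tree this is a balanced cycle of
   length 2k.  Graphs without such chorded cycles have at most (k-1)|V| edges, so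
   summing the degrees over V_i gives |V_(i+1)| > q |V_i| for all i < k, and
   |V_k| > q^k = n is absurd. *)

(** * Chorded cycles in dense graphs *)

Section DegreeSums.
Variables (T : finType) (e : rel T).
Hypotheses (e_sym : symmetric e) (e_irr : irreflexive e).

Definition nbhd (W : {set T}) (x : T) : {set T} := [set y in W | e x y].
Definition arcs (W : {set T}) : nat := \sum_(x in W) #|nbhd W x|.

Lemma nbhdE W x : #|nbhd W x| = \sum_(y in W) e x y.
Proof.
rewrite -sum1_card (eq_bigl (fun y => (y \in W) && e x y)); last by move=> y; rewrite inE.
by rewrite big_mkcondr; apply: eq_bigr => y _; case: (e x y).
Qed.

(** By symmetry the arcs from [W :\: A] into [A] are as many as those from [A] into [W :\: A], which
    gives the second summand. *)
Lemma arcs_setD (W A : {set T}) : A \subset W ->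
  arcs W = arcs (W :\: A) + \sum_(x in A) (#|nbhd W x| + #|nbhd (W :\: A) x|).
Proof.
move=> sAW; have split F : \sum_(x in W) F x = \sum_(x in W :\: A) F x + \sum_(x in A) F x.
  by rewrite (big_setID A) /= (setIidPr sAW) addnC.
rewrite big_split /= addnCA addnC /arcs split; congr addn.
under eq_bigr => x _ do rewrite nbhdE split -nbhdE.
rewrite big_split /=; congr addn.
rewrite exchange_big /=; apply: eq_bigr => x xA; rewrite nbhdE.
by apply: eq_bigr => y _; rewrite e_sym.
Qed.

Lemma arcs_setD1 (W : {set T}) x : x \in W ->
  arcs W = arcs (W :\ x) + (#|nbhd W x|).*2.
Proof.
move=> xW; rewrite (@arcs_setD W [set x]) ?sub1set // big_set1; congr (_ + _).
rewrite -addnn; congr (_ + _); apply: eq_card => y; rewrite !inE.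
by case: eqP => [-> | _] //; rewrite e_irr !andbF.
Qed.

(** The cycle is rotated so that the chord starts at index 0; the bounds on [r] keep the chord from
    being an edge of the cycle. *)
Definition chorded_cycle (x0 : T) (s : seq T) (r : nat) : bool :=
  [&& uniq s, cycle e s, 1 < r, r.+1 < size s & e (nth x0 s 0) (nth x0 s r)].

(** If the farthest neighbour of [x] had index [j >= h], the edge to it would close a cycle on
    [j.+1 > h] vertices, and a third neighbour of [x] would give a chord. *)
Lemma head_nbhd_prefix (h : nat) (W : {set T}) (x : T) (p : seq T) :
  (forall (x0 : T) s r, h < size s -> {subset s <= W} -> ~~ chorded_cycle x0 s r) ->
  2 < #|nbhd W x| ->
  uniq (x :: p) -> path e x p -> {subset x :: p <= W} ->
  {subset nbhd W x <= x :: p} ->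
  {subset nbhd W x <= take h (x :: p)}.
Proof.
move=> nochord deg3 up pp sW sub.
pose far := [pred j | (j < size (x :: p)) && e x (nth x (x :: p) j)].
have farN z : z \in nbhd W x -> far (index z (x :: p)).
  move=> zN; rewrite [far _]/(_ && _) index_mem sub // nth_index ?sub //.
  by move: zN; rewrite inE => /andP[].
have [y yN] : exists y, y \in nbhd W x by apply/set0Pn; rewrite -card_gt0; lia.
have exfar : exists j, far j by exists (index y (x :: p)); apply: farN.
have bfar j : far j -> j <= size (x :: p) by case/andP=> /ltnW.
case: (ex_maxnP exfar bfar) => j /andP[js ej] jmax.
suff jh : j < h.
  move=> z zN; have zs := sub _ zN; have zj := jmax _ (farN _ zN).
  have zi : index z (x :: p) < h by lia.
  by rewrite -(nth_index x zs) -(nth_take _ zi) mem_nth // size_take;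
     move: zs; rewrite -index_mem; case: ifP; lia.
rewrite ltnNge; apply/negP => hj.
have [z] : exists z, z \in nbhd W x :\: [set nth x (x :: p) 1; nth x (x :: p) j].
  apply/set0Pn; rewrite -card_gt0 cardsD.
  have := subset_leq_card (subsetIr (nbhd W x) [set nth x (x :: p) 1; nth x (x :: p) j]).
  by rewrite cards2; case: (_ != _); lia.
rewrite !inE negb_or => /andP[/andP[z1 zj] /andP[zW ez]].
have zN : z \in nbhd W x by rewrite inE zW.
have zs := sub _ zN; have rj := jmax _ (farN _ zN).
have nz := nth_index x zs; set r := index z (x :: p) in rj nz.
have r0 : r != 0 by apply: contraTneq ez => r0; rewrite -nz r0 /= e_irr.
have r1 : r != 1 by apply: contraNneq z1 => r1E; rewrite -nz r1E.
have rj2 : r != j by apply: contraNneq zj => rjE; rewrite -nz rjE.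
have j0 : 0 < j by lia.
have sj : size (take j.+1 (x :: p)) = j.+1 by rewrite size_takel.
have := nochord x (take j.+1 (x :: p)) r; rewrite sj ltnS hj => /(_ isT) H.
have /negP := H (fun t ht => sW t (mem_take ht)); apply.
have nr : nth x (take j.+1 (x :: p)) r = z by rewrite nth_take //; lia.
rewrite /chorded_cycle sj take_uniq // nr /= ez andbT.
apply/andP; split; last by apply/andP; split; lia.
rewrite rcons_path take_path //= e_sym.
have -> : last x (take j p) = nth x (x :: p) j; last by [].
rewrite (last_nth x) size_takel // -[x :: take j p]/(take j.+1 (x :: p)).
by rewrite nth_take.
Qed.

(** A Pósa rotation: the edge from [x] to [y] lets the part before [y] be reversed, and the
    predecessor of [y] becomes the first vertex. *)
Lemma rotate_path (x y : T) (p1 p2 : seq T) :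
  path e x (p1 ++ y :: p2) -> e x y -> sorted e (rev (x :: p1) ++ y :: p2).
Proof.
rewrite cat_path /= => /and3P[p1P _ p2P] exy.
rewrite sorted_cat_cons p2P andbT rev_cons -!cats1 -catA /= -[_ ++ _]revK rev_sorted.
rewrite rev_cat revK /= exy /=; apply: sub_path p1P => a b; by rewrite e_sym.
Qed.

(* Woodall's argument: among the longest paths take one whose first vertex has
   largest degree d.  Rotations give d first vertices of longest paths, all of
   whose neighbours are among the first 2h vertices; deleting these d vertices
   destroys at most 2hd arcs.  Vertices of degree at most h are deleted
   beforehand, so that a long cycle closed by a first vertex has a chord. *)
Lemma arcs_no_chorded_cycle (h : nat) (W : {set T}) : 1 < h ->
  (forall (x0 : T) s r, h.*2 < size s -> {subset s <= W} -> ~~ chorded_cycle x0 s r) ->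
  arcs W <= h.*2 * #|W|.
Proof.
move=> h1; move: {2}#|W| (leqnn #|W|) => n; elim: n W => [|n IHn] W cW nochord.
  by rewrite /arcs big_pred0 // => x; move: cW; rewrite leqn0 cards_eq0 => /eqP->; rewrite inE.
have [[v vW vdeg]|mindeg] : (exists2 v, v \in W & #|nbhd W v| <= h) \/
    (forall v, v \in W -> h < #|nbhd W v|).
  case: (boolP [exists v in W, #|nbhd W v| <= h]) => [/exists_inP[v]|/exists_inPn H].
    by left; exists v.
  by right=> v /H; rewrite -ltnNge.
  have cW' := cardsD1 v W; rewrite vW in cW'.
  have := IHn (W :\ v); rewrite (arcs_setD1 vW) cW' => IH.
  have : arcs (W :\ v) <= h.*2 * #|W :\ v|; last by lia.
  apply: IH => [|x0 s r hs sW]; first by lia.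
  by apply: nochord => // t /sW; rewrite inE => /andP[].
have [->|[w wW]] := set_0Vmem W; first by rewrite /arcs big_set0.
pose hd (s : seq T) := head w s.
pose good (s : seq T) := [&& uniq s, sorted e s, all (mem W) s & s != [::]].
(* The weight [#|T|.+1] exceeds every degree, so [m] orders paths by length first and by the degree
   of the head second. *)
pose m (s : seq T) := size s * #|T|.+1 + #|nbhd W (hd s)|.
have size_good s : good s -> size s <= #|T| by case/and4P=> /card_uniqP <- *; apply: max_card.
have nbhd_small V v : #|nbhd V v| <= #|T| by apply: max_card.
have [s [gs smax]] : exists s, good s /\ forall s', good s' -> m s' <= m s.
  pose P := fun i => [exists k : 'I_(#|T|.+1), [exists t : k.-tuple T, good t && (m t == i)]].
  have inP s : good s -> P (m s).
    move=> gs; have ks : size s < #|T|.+1 by rewrite ltnS size_good.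
    by apply/existsP; exists (Ordinal ks); apply/existsP; exists (in_tuple s); rewrite gs eqxx.
  have exP : exists i, P i.
    by exists (m [:: w]); apply: inP; rewrite /good /= wW.
  have bP i : P i -> i <= #|T| * #|T|.+1 + #|T|.
    case/existsP=> k /existsP[t /andP[gt /eqP <-]].
    by rewrite leq_add ?leq_mul2r ?size_good.
  case: (ex_maxnP exP bP) => i /existsP[k /existsP[t /andP[gt /eqP ti]]] imax.
  by exists t; split=> // s' /inP/imax; rewrite ti.
have longest s' : good s' -> size s' = size s -> {subset nbhd W (hd s') <= take h.*2 s'}.
  case: s' => [/and4P[] // | x p] gs' eqs; case/and4P: (gs') => up pp /allP sW _.
  have xW : x \in W by apply: sW; rewrite mem_head.
  apply: head_nbhd_prefix => //; first by apply: leq_trans (mindeg _ xW).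
  (* A neighbour off the path would extend it and so increase [m]. *)
  move=> y; rewrite inE => /andP[yW exy]; apply: contraT => yN.
  have /smax : good (y :: x :: p).
    apply/and4P; split=> //; first by rewrite cons_uniq yN.
      by rewrite /= e_sym exy.
    by apply/allP=> z; rewrite inE => /predU1P[->|/sW].
  rewrite /m -eqs [size (y :: _)]/= mulSn; have := nbhd_small W (hd s).
  by move: (size (x :: p) * _)%N; lia.
case: s gs smax longest => [/and4P[] // | x p] gs smax longest.
case/and4P: (gs) => up pp /allP sW _.
pose c := h.*2; pose C := [set y in take c (x :: p)].
have cC : #|C| <= c.
  by rewrite cardsE; apply: leq_trans (card_size _) _; rewrite size_take; case: ifP; lia.
have xsub : {subset nbhd W x <= take c (x :: p)} by apply: (longest (x :: p) gs).
(* [A] collects the heads of the rotated paths, one for each neighbour of [x]. *)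
pose pred_of y := nth w (x :: p) (index y (x :: p)).-1.
pose A := pred_of @: nbhd W x.
have splitN y : y \in nbhd W x -> exists p1 p2, [/\ p = p1 ++ y :: p2, pred_of y = last x p1,
    last x p1 \in take c (x :: p), take c (x :: p) =i take c (rev (x :: p1) ++ y :: p2) &
    good (rev (x :: p1) ++ y :: p2)].
  move=> yN; have ytk := xsub _ yN; have ys := mem_take ytk.
  move: (yN); rewrite inE => /andP[yW exy].
  have yp : y \in p by move: ys; rewrite inE; case: eqP exy => // <-; rewrite e_irr.
  have ic := index_ltn ytk.
  case/splitPr: yp up pp sW ytk ic @pred_of {A} => p1 p2 up pp sW ytk ic pred_of.
  have iy : index y (x :: p1 ++ y :: p2) = (size p1).+1.
    rewrite -cat_cons index_cat /= eqxx addn0; case: ifP => // yp1.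
    by move: up; rewrite -cat_cons cat_uniq /= yp1 andbF.
  (* As [y] is among the first [c] vertices, the rotation only permutes these, and [C] serves all
     rotated paths. *)
  have tk q : size q = (size p1).+1 ->
      take c (q ++ y :: p2) = q ++ take (c - (size p1).+1) (y :: p2).
    by move=> sq; rewrite take_cat sq ltnNge; move: ic; rewrite iy => /ltnW ->.
  exists p1, p2; split=> //.
  - by rewrite /pred_of iy /= -cat_cons nth_cat /= ltnS leqnn (last_nth w).
  - by rewrite -cat_cons tk // mem_cat mem_last.
  - by move=> z; rewrite -cat_cons !tk ?size_rev // !mem_cat mem_rev.
  have pe : perm_eq (rev (x :: p1) ++ y :: p2) (x :: p1 ++ y :: p2).
    by rewrite -cat_cons perm_cat2r perm_rev.
  apply/and4P; split; first by rewrite (perm_uniq pe).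
  - exact: rotate_path.
  - by rewrite (perm_all _ pe); apply/allP.
  - by rewrite -size_eq0 (perm_size pe).
have cA : #|A| = #|nbhd W x|.
  rewrite card_in_imset // => y z yN zN.
  have idx t : t \in nbhd W x -> 0 < index t (x :: p) < size (x :: p).
    move=> tN; rewrite index_mem (mem_take (xsub _ tN)) andbT /=; case: eqP => // xt.
    by move: tN; rewrite -xt inE e_irr andbF.
  have [/andP[iy ly] /andP[iz lz]] := (idx y yN, idx z zN).
  move/eqP; rewrite nth_uniq ?(leq_ltn_trans (leq_pred _)) // => /eqP yz.
  rewrite -(nth_index w (mem_take (xsub _ yN))) -(nth_index w (mem_take (xsub _ zN))).
  by congr nth; lia.
have endA y : y \in A -> [/\ #|nbhd W y| <= #|nbhd W x|, nbhd W y \subset C, y \in C & y \in W].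
  case/imsetP=> z /splitN[p1 [p2 [eqp -> lC tkE gs']]] ->.
  have sz : size (rev (x :: p1) ++ z :: p2) = size (x :: p).
    by rewrite eqp !size_cat size_rev /= !size_cat.
  have hdE : hd (rev (x :: p1) ++ z :: p2) = last x p1.
    by rewrite /hd lastI rev_rcons.
  split; last by apply: sW; apply: mem_take lC.
  - by have := smax _ gs'; rewrite /m sz hdE /= leq_add2l.
  - apply/subsetP=> t tN; rewrite inE tkE; apply: longest => //; by rewrite hdE.
  - by rewrite inE.
have AC : A \subset C by apply/subsetP=> y /endA[].
have AW : A \subset W by apply/subsetP=> y /endA[].
have A0 : 0 < #|A|.
  by rewrite cA; apply: leq_ltn_trans (mindeg _ _) => //; apply: sW; rewrite mem_head.
(* By the choice of [x] the first term is at most [#|A|]; the neighbours outside [A] lie in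
   [C :\: A], so the second is at most [c - #|A|]. *)
have bound : \sum_(y in A) (#|nbhd W y| + #|nbhd (W :\: A) y|) <= #|A| * c.
  rewrite -sum_nat_const; apply: leq_sum => y yA; have [dy sy _ _] := endA y yA.
  have : #|nbhd (W :\: A) y| <= #|C :\: A|.
    apply/subset_leq_card/subsetP => z; rewrite !inE => /andP[/andP[zA zW] ez].
    have : z \in C by apply: (subsetP sy); rewrite inE zW.
    by rewrite zA inE => ->.
  have := cardsID A C; rewrite (setIidPr AC); lia.
have cWA : #|W| = #|A| + #|W :\: A| by rewrite -(cardsID A W) (setIidPr AW).
have IH : arcs (W :\: A) <= c * #|W :\: A|.
  apply: IHn => [|x0 r s hs sWA]; first by lia.
  by apply: nochord => // t /sWA; rewrite inE => /andP[].
rewrite (arcs_setD AW) cWA mulnDr addnC [c * #|A|]mulnC; exact: leq_add.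
Qed.

End DegreeSums.

(** * Paths in a cycle with a chord *)

Section Periods.
Local Open Scope ring_scope.
Variables (C : eqType) (c : int -> C).

Definition periodic (q : int) := forall z, c (z + q) = c z.

Lemma periodicM (q m : int) : periodic q -> periodic (q * m).
Proof.
move=> cq; have cqn n z : c (z + q * n%:Z) = c z.
  elim: n z => [|n IHn] z; first by rewrite mulr0 addr0.
  by rewrite -[in RHS](IHn z) -(cq (z + q * n%:Z)); congr c; lia.
case: m => n z; first exact: cqn.
by rewrite -(cqn n.+1 (z + _)); congr c; rewrite NegzE; lia.
Qed.

(** Periods can be tested on the residues modulo [N], so a least one exists; the remainder of any
    period modulo it is again a period. *)
Lemma least_period (N : nat) : (0 < N)%N -> periodic N ->
  exists2 p : nat, (0 < p)%N & periodic p /\ forall q : int, periodic q -> (p %| q)%Z.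
Proof.
move=> N0 cN; pose per p := (0 < p)%N && [forall i : 'I_N, c (i%:Z + p%:Z) == c i%:Z].
have perP p : (0 < p)%N -> reflect (periodic p) (per p).
  move=> p0; rewrite /per p0; apply: (iffP forallP) => [cp z | cp i]; last by rewrite cp.
  have lt : (`|(z %% N%:Z)%Z| < N)%N by lia.
  have /eqP := cp (Ordinal lt); rewrite /= => E.
  have zE : z = `|(z %% N%:Z)%Z|%N%:Z + N%:Z * (z %/ N%:Z)%Z by lia.
  have cNq y := periodicM (z %/ N%:Z)%Z cN y.
  by rewrite zE addrAC !cNq E.
have exper : exists p, per p by exists N; apply/(perP _ N0).
case: (ex_minnP exper) => p pp pmin.
have p0 : (0 < p)%N by case/andP: pp.
exists p => //; have cp := perP _ p0 pp; split=> // q cq.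
have cr : periodic (q %% p%:Z)%Z.
  move=> z; rewrite -(periodicM (q %/ p%:Z)%Z cp) -[in RHS](cq z); congr c; lia.
case: (posnP `|(q %% p%:Z)%Z|%N) => [|r0]; first by lia.
have /pmin : per `|(q %% p%:Z)%Z|%N; last by lia.
by apply/(perP _ r0) => z; rewrite -[in RHS](cr z); congr c; lia.
Qed.
End Periods.

Section Theta.
Local Open Scope ring_scope.
Variables (T : eqType) (g : T -> T -> bool).
Hypothesis g_sym : forall x y, g x y = g y x.

(* A cycle of length N, indexed by the integers modulo N, with a chord between
   the vertices of index 0 and r. *)
Definition theta (v : int -> T) (N r : nat) : Prop :=
  [/\ forall z, v (z + N%:Z) = v z,
      forall z, g (v z) (v (z + 1)),
      forall a b : int, a <= b -> b < a + N%:Z -> v a = v b -> a = b,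
      g (v 0) (v r%:Z) & (1 < r)%N && (r.+1 < N)%N].

Definition is_path (l : nat) (u : nat -> T) : Prop :=
  (forall t, (t < l)%N -> g (u t) (u t.+1)) /\
  (forall a b, (a <= b)%N -> (b <= l)%N -> u a = u b -> a = b).

(** Traversed backwards, the cycle has the far end of the chord at index [- r], which is [N - r]
    modulo [N]. *)
Lemma theta_opp v N r : theta v N r -> theta (fun z => v (- z)) N (N - r).
Proof.
case=> vN vg vinj vr rN; have rN' := rN; split.
- by move=> z; rewrite -(vN (- (z + N%:Z))); congr v; lia.
- by move=> z; rewrite g_sym; have := vg (- (z + 1)); congr (g _ (v _)); lia.
- by move=> a b ab bN /esym/vinj; lia.
- rewrite oppr0; move: vr; congr (g _ _); rewrite -(vN (- _)); congr v; lia.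
- lia.
Qed.

Lemma theta_modz v N r z : theta v N r -> v (z %% N%:Z)%Z = v z.
Proof.
case=> vN _ _ _ _; rewrite -(periodicM (z %/ N%:Z)%Z vN); congr v; lia.
Qed.

Section Colour.
Variables (chi : T -> bool) (l : nat).

Definition closed_under_paths (v : int -> T) := forall u : nat -> T,
  is_path l u -> (forall t, exists z, u t = v z) -> chi (u 0%N) -> chi (u l).

(** The converse implication comes from the reversed path. *)
Lemma closed_paths_eq v u : closed_under_paths v ->
  is_path l u -> (forall t, exists z, u t = v z) -> chi (u l) = chi (u 0%N).
Proof.
move=> vcl up uv; apply/idP/idP; last exact: vcl.
have := vcl (fun t => u (l - t)%N); rewrite subn0 subnn; apply=> [|t]; last exact: uv.
case: up => ug uinj; split=> [t tl|a b ab bl /esym/uinj]; last by lia.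
by rewrite g_sym (_ : l - t = (l - t.+1).+1)%N; [apply: ug | ]; lia.
Qed.

(** As [l < N], any [l] consecutive edges of the cycle form a path. *)
Lemma theta_shift v N r : theta v N r -> closed_under_paths v -> (l < N)%N ->
  periodic (chi \o v) l.
Proof.
move=> [vN vg vinj vr rN] vcl lN z /=.
have := @closed_paths_eq v (fun t => v (z + t%:Z)) vcl; rewrite addr0; apply.
  split=> [t tl|a b ab bl /vinj]; last by lia.
  by have := vg (z + t%:Z); congr (g _ (v _)); lia.
by move=> t; exists (z + t%:Z).
Qed.

(* From the path with indices -j, ..., 0, r, ..., r + l - 1 - j, for 0 <= j < l. *)
Lemma theta_translate v N r : theta v N r -> closed_under_paths v -> (0 < l)%N ->
  (l < N)%N -> (l <= N - r)%N -> periodic (chi \o v) (r%:Z - 1).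
Proof.
move=> th vcl l0 lN lr; have cl := theta_shift th vcl lN.
case: th => [vN vg vinj vr rN] z /=.
(* Since [l] is a period, [z] may be replaced by [- j] with [0 <= j < l]. *)
pose j := `|((- z) %% l%:Z)%Z|%N.
have jl : (j < l)%N by lia.
have zE : z = - j%:Z + l%:Z * (- ((- z) %/ l%:Z)%Z) by lia.
have -> : chi (v z) = chi (v (- j%:Z)).
  by rewrite {1}zE; exact: (periodicM _ cl).
pose w (t : nat) : int := if (t <= j)%N then t%:Z - j%:Z else r%:Z + t%:Z - j%:Z - 1.
have w0 : w 0%N = - j%:Z by rewrite /w leq0n sub0r.
have wl : w l = r%:Z + l%:Z - j%:Z - 1 by rewrite /w leqNgt jl.
have := @closed_paths_eq v (v \o w) vcl; rewrite /= w0 wl => <-.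
- have := periodicM (- ((- z) %/ l%:Z)%Z - 1) cl (r%:Z + l%:Z - j%:Z - 1).
  by rewrite /= => <-; congr (chi (v _)); lia.
- split=> [t tl|a b ab bl /=].
    rewrite /= /w; case: (ltngtP t j) => tj; rewrite ?ltnW //.
    + by have := vg (t%:Z - j%:Z); congr (g _ (v _)); lia.
    + by have := vg (r%:Z + t%:Z - j%:Z - 1); congr (g _ (v _)); lia.
    + by move: vr; congr (g (v _) (v _)); lia.
  by rewrite /w => /vinj; move: (bl) (ab); do 2 case: ifP; lia.
- by move=> t; exists (w t).
Qed.

(* From the path with indices j, ..., 0, r, ..., r + l - 1 - j, for the j between
   max (0, r + l - N) and min (r, l) - 1; there are at least p of them. *)
Lemma theta_reflect v N r (p : nat) : theta v N r -> closed_under_paths v ->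
  (0 < p)%N -> periodic (chi \o v) p -> (l < N)%N ->
  (p <= r)%N -> (p <= l)%N -> (p <= N - r)%N -> (p <= N - l)%N ->
  forall z, chi (v z) = chi (v (r%:Z - 1 - z)).
Proof.
move=> th vcl p0 cp lN pr pl pNr pNl; have cl := theta_shift th vcl lN.
case: th => [vN vg vinj vr rN] z.
(* The truncated subtraction makes [a] the maximum of 0 and r + l - N, and [j] represents [z] modulo
   [p] in the window from [a] to [a + p - 1]. The four bounds on [p] put this window below [r] and
   [l]; [j >= a] keeps the path from wrapping round to index 0. *)
pose a := (r + l - N)%N; pose j := (a + `|((z - a%:Z) %% p%:Z)%Z|)%N.
have ja : (a <= j < a + p)%N by lia.
have zE : z = j%:Z + p%:Z * ((z - a%:Z) %/ p%:Z)%Z by lia.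
have -> : chi (v z) = chi (v j%:Z) by rewrite {1}zE; exact: (periodicM _ cp).
have -> : chi (v (r%:Z - 1 - z)) = chi (v (r%:Z + l%:Z - 1 - j%:Z)).
  have /= <- := periodicM ((z - a%:Z) %/ p%:Z)%Z cp (r%:Z - 1 - z).
  have /= E := cl (r%:Z - 1 - j%:Z).
  by transitivity (chi (v (r%:Z - 1 - j%:Z))); [|rewrite -E]; congr (chi (v _)); lia.
pose w (t : nat) : int := if (t <= j)%N then j%:Z - t%:Z else r%:Z + t%:Z - j%:Z - 1.
have jl : (j < l)%N by lia.
have w0 : w 0%N = j%:Z by rewrite /w leq0n subr0.
have wl : w l = r%:Z + l%:Z - 1 - j%:Z by rewrite /w leqNgt jl /=; lia.
have := @closed_paths_eq v (v \o w) vcl; rewrite /= w0 wl => -> //.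
- split=> [t tl|b b' ab bl /=].
    rewrite /= /w; case: (ltngtP t j) => tj; rewrite ?ltnW //.
    + by rewrite g_sym; have := vg (j%:Z - t.+1%:Z); congr (g _ (v _)); lia.
    + by have := vg (r%:Z + t%:Z - j%:Z - 1); congr (g _ (v _)); lia.
    + by move: vr; congr (g (v _) (v _)); lia.
  move=> E; have : w b = w b'; last by rewrite /w; do 2 case: ifP; lia.
  case: (leP (w b) (w b')) => ww.
    by apply: vinj; rewrite // /w; do 2 case: ifP; lia.
  by apply/esym/vinj; rewrite ?(ltW ww) // /w; do 2 case: ifP; lia.
- by move=> t; exists (w t).
Qed.

(* The least period p divides l and N.  Translations rule out r < p and N - r < p;
   then the reflections of the theta and of its mirror image compose to the
   translation by 2. *)
Lemma theta_colouring v N r z1 z2 : theta v N r -> closed_under_paths v ->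
  (0 < l)%N -> (l < N)%N -> chi (v z1) -> ~~ chi (v z2) ->
  [/\ ~~ odd N, odd r & forall z, chi (v (z + 1)) = ~~ chi (v z)].
Proof.
move=> th vcl l0 lN c1 c2; pose c := chi \o v.
have th' := theta_opp th; have cl : periodic c l := theta_shift th vcl lN.
have vcl' : closed_under_paths (fun z => v (- z)).
  by move=> u up uv; apply: vcl => // t; have [z ->] := uv t; exists (- z).
have rN : (1 < r)%N && (r.+1 < N)%N by case: th.
have cN : periodic c N by case: th => vN *; move=> z; rewrite /c /= vN.
have [|p p0 [cp pdiv]] := least_period _ cN; first by lia.
have [pl pN] := (pdiv _ cl, pdiv _ cN).
have pleN : (p <= l)%N by apply: dvdn_leq.
have pleNl : (p <= N - l)%N by apply: dvdn_leq; [rewrite subn_gt0 | apply: dvdn_sub].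
have pr : (p <= r)%N.
  rewrite leqNgt; apply/negP => rp.
  have := pdiv _ (theta_translate th vcl l0 lN _) => /(_ ltac:(lia)) d.
  have : (p <= r.-1)%N; last by lia.
  by apply: dvdn_leq; [lia | rewrite (_ : r%:Z - 1 = r.-1%:Z) in d; lia].
have pNr : (p <= N - r)%N.
  rewrite leqNgt; apply/negP => rp.
  have := pdiv ((N - r)%N%:Z - 1).
  have pe := theta_translate th' vcl' l0 lN _.
  have pe' : periodic c ((N - r)%N%:Z - 1).
    move=> z; have := pe ltac:(lia) (- z - ((N - r)%N%:Z - 1)).
    by rewrite /c /= subrK opprK => ->; congr (chi (v _)); lia.
  move=> /(_ pe') d.
  have : (p <= (N - r).-1)%N; last by lia.
  by apply: dvdn_leq; [lia | rewrite (_ : (N - r)%N%:Z - 1 = (N - r).-1%:Z) in d; lia].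
have R1 := theta_reflect th vcl p0 cp lN pr pleN pNr pleNl.
have cp' : periodic (chi \o (fun z => v (- z))) p.
  by move=> z /=; rewrite -[LHS](cp (- (z + p%:Z))) /c /=; congr (chi (v _)); lia.
have R2 := theta_reflect th' vcl' p0 cp' lN pNr pleN ltac:(lia) pleNl.
(* Modulo [N] the reflections send z to r - 1 - z and to r + 1 - z. *)
have c_2 : periodic c 2.
  move=> z; have /= E2 := R2 (z + 1 - r%:Z); have /= E3 := cN (z + 2 - N%:Z).
  transitivity (c (z + 2 - N%:Z)); first by rewrite -E3 subrK.
  rewrite /c /= (R1 z); transitivity (chi (v (- (z + 1 - r%:Z)))); last by congr (chi (v _)); lia.
  by rewrite E2; congr (chi (v _)); lia.
have alt z : c (z + 1) = ~~ c z.
  suff : c (z + 1) != c z by case: (c _); case: (c z).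
  apply/negP => /eqP E.
  have cst y : c y = c z.
    have := periodicM ((y - z) %/ 2)%Z c_2 z; have := periodicM ((y - z) %/ 2)%Z c_2 (z + 1).
    case: (eqVneq ((y - z) %% 2)%Z 0) => yz.
      by move=> _ <-; congr c; lia.
    by rewrite -E => <- _; congr c; lia.
  by have := c2; rewrite -[chi _]/(c z2) (cst z2) -(cst z1) [c z1]c1.
have altn n z : c (z + n%:Z) = odd n (+) c z.
  elim: n => [|n IHn]; first by rewrite addr0.
  by rewrite (_ : z + n.+1%:Z = z + n%:Z + 1); [rewrite alt IHn addNb | lia].
split=> //; first by have := altn N 0; rewrite cN; case: odd; case: (c 0).
(* The reflection takes 0 to r - 1; the colours alternate, so r - 1 is even. *)
have R10 : c (r%:Z - 1) = c 0 by rewrite /c /= (R1 0) subr0.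
have := altn r 0; rewrite add0r; have := alt (r%:Z - 1); rewrite subrK R10 => ->.
by case: odd; case: (c 0).
Qed.

End Colour.
End Theta.

(** * Chorded cycles between consecutive levels of a tree *)

Lemma chorded_cycle_theta (T : finType) (g : rel T) (x0 : T) (s : seq T) (r : nat) :
  chorded_cycle g x0 s r ->
  theta g (fun z : int => nth x0 s `|(z %% Posz (size s))%Z|%N) (size s) r.
Proof.
case/and5P=> us cs r1 rs gr; have N0 : 0 < size s by lia.
have idx z : `|(z %% Posz (size s))%Z|%N < size s by lia.
split=> //; last by rewrite r1.
- by move=> z; rewrite modzDr.
- move=> z; set j := `|(z %% Posz (size s))%Z|%N; have jN : j < size s := idx z.
  have -> : `|((z + 1) %% Posz (size s))%Z|%N = if j.+1 < size s then j.+1 else 0.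
    rewrite -modzDml (_ : (z %% Posz (size s))%Z = Posz j); last by lia.
    rewrite (_ : (Posz j + 1)%R = Posz j.+1); last by lia.
    rewrite modz_nat absz_nat; case: ltnP => jN1; first by rewrite modn_small.
    by rewrite (_ : j.+1 = size s) ?modnn //; lia.
  have := next_cycle cs (mem_nth x0 jN); rewrite next_nth mem_nth // index_uniq //.
  case: s us cs rs gr N0 idx j jN => // y p us cs rs gr N0 idx j jN.
  case: ltnP => jp; first by rewrite [nth y p j](set_nth_default x0).
  by rewrite (nth_default y).
- move=> a b ab bN /eqP; rewrite nth_uniq //.
  move=> /eqP E; have {}E : (b = a %[mod Posz (size s)])%Z by lia.
  have := modz_small (_ : (0 <= (b - a)%R < Posz (size s))%R) => /(_ ltac:(lia)).
  by move/eqP: E; rewrite eqz_mod_dvd => /dvdz_mod0P ->; lia.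
- by rewrite /= mod0z modz_small //; lia.
Qed.

(* Signs are booleans, true for -1, as in the signatures.  [par] is the parent
   function of a rooted tree and [sw] a switching that makes its edges positive,
   so an edge x y has the sign [sg x y (+) (sw x (+) sw y)] after switching. *)
Section LevelStructure.
Variables (T : finType) (e : rel T) (k : nat) (lev : T -> nat) (par : T -> T).
Variables (sg : T -> T -> bool) (sw : T -> bool).
Hypotheses (e_sym : symmetric e) (sg_sym : forall x y, sg x y = sg y x).
Hypothesis root_uniq : forall x y, lev x = 0 -> lev y = 0 -> x = y.
Hypothesis par_edge : forall x, 0 < lev x <= k -> e x (par x).
Hypothesis par_lev : forall x, 0 < lev x <= k -> lev (par x) = (lev x).-1.
Hypothesis par_sign : forall x, 0 < lev x <= k -> sg x (par x) = sw x (+) sw (par x).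
Hypothesis no_positive_cycle : forall w : nat -> T, w (2 * k) = w 0 ->
  (forall t, t < 2 * k -> e (w t) (w t.+1)) ->
  (forall a b, a <= b -> b < 2 * k -> w a = w b -> a = b) ->
  \big[addb/false]_(t < 2 * k) sg (w t) (w t.+1).

Lemma lev_anc j x : j <= lev x -> lev x <= k -> lev (iter j par x) = lev x - j.
Proof.
move=> jx xk; elim: j jx => [|j IHj] jx; first by rewrite subn0.
by rewrite iterS par_lev IHj; lia.
Qed.

(** Switching changes the sign of a walk only through its two ends, hence not at all for a closed
    walk. *)
Lemma addb_telescope (w : nat -> T) (F : nat -> bool) n :
  (forall t, t < n -> sg (w t) (w t.+1) = F t (+) (sw (w t) (+) sw (w t.+1))) ->
  \big[addb/false]_(t < n) sg (w t) (w t.+1) =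
    \big[addb/false]_(t < n) F t (+) (sw (w 0) (+) sw (w n)).
Proof.
elim: n => [|n IHn] H; first by rewrite !big_ord0 addbb.
rewrite !big_ord_recr /= IHn; last by move=> t tn; apply: H; apply: ltnW.
by rewrite H // addbACA -(addbA (sw (w 0))) addKb.
Qed.

Section OneLevel.
Variables (i : nat) (b : bool) (g : rel T).
Hypothesis ik : i < k.
Hypothesis g_edge : forall x y, g x y -> e x y.
Hypothesis g_sign : forall x y, g x y -> sg x y = b (+) (sw x (+) sw y).
Hypothesis g_lev : forall x y, g x y -> i <= lev x.

(** If the ancestors m - 1 levels up differed, [u] and the two tree paths to the common ancestor
    would form a cycle of length 2(k - m) + 2m = 2k. After switching, its tree edges are positive
    and the even number of other edges all have sign [b], so it would be balanced. *)
Lemma level_path_ancestor (m : nat) (u : nat -> T) :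
  0 < m <= i -> is_path g (2 * (k - m)) u ->
  lev (u 0) = i -> lev (u (2 * (k - m))) = i ->
  iter m par (u 0) = iter m par (u (2 * (k - m))) ->
  iter m.-1 par (u 0) = iter m.-1 par (u (2 * (k - m))).
Proof.
set l := 2 * (k - m) => /andP[m0 mi] [ug uinj] l0 ll ancm.
apply/eqP/negPn/negP => /eqP ancm1.
(* The cycle follows [u], climbs from [u l] to the common ancestor and descends to [u 0]. *)
pose w t := if t <= l then u t else if t <= l + m then iter (t - l) par (u l)
            else iter (2 * k - t) par (u 0).
have ulev t : t <= l -> i <= lev (u t).
  move=> tl; case: (ltnP t l) => [/ug/g_lev//|lt].
  by rewrite (_ : t = l) ?ll //; lia.
have w1 t : t <= l -> w t = u t by rewrite /w => ->.
have w2 t : l <= t <= l + m -> w t = iter (t - l) par (u l).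
  case/andP=> lt tm; rewrite /w tm; case: leqP => // tl.
  by rewrite (_ : t = l) ?subnn //; lia.
have w3 t : l + m <= t -> w t = iter (2 * k - t) par (u 0).
  move=> lt; have [tE|tn] := eqVneq t (l + m).
    by rewrite w2 ?tE ?leqnn ?leq_addr // addKn -ancm; congr iter; lia.
  have /negbTE tl' : ~~ (t <= l) by lia.
  by have /negbTE tm : ~~ (t <= l + m); [lia | rewrite /w tl' tm].
have lev2 t : l <= t <= l + m -> lev (w t) = i - (t - l).
  by move=> H; rewrite w2 // lev_anc ll //; lia.
have lev3 t : l + m <= t <= 2 * k -> lev (w t) = i - (2 * k - t).
  by move=> H; rewrite w3 ?lev_anc ?l0 //; lia.
have wper : w (2 * k) = w 0 by rewrite w3 ?w1 // ?subnn //; lia.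
have step t : t < 2 * k -> e (w t) (w t.+1) /\
    sg (w t) (w t.+1) = (b && (t < l)) (+) (sw (w t) (+) sw (w t.+1)).
  move=> t2k; case: (ltnP t l) => tl.
    rewrite !w1 ?(ltnW tl) // andbT; split; [exact/g_edge/ug | exact/g_sign/ug].
  rewrite andbF /=; case: (ltnP t (l + m)) => tm.
    have -> : w t.+1 = par (w t) by rewrite !w2 ?subSn // ?tl ?(ltnW tm) ?(leqW tl) //.
    have ok : 0 < lev (w t) <= k by rewrite lev2; lia.
    by split; [apply: par_edge | apply: par_sign].
  have -> : w t = par (w t.+1).
    by rewrite !w3 ?(leqW tm) // -iterS; congr iter; lia.
  have ok : 0 < lev (w t.+1) <= k by rewrite lev3; lia.
  by rewrite e_sym sg_sym addbC; split; [apply: par_edge | apply: par_sign].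
have := no_positive_cycle wper (fun t h => proj1 (step t h)).
rewrite (@addb_telescope w (fun t => b && (t < l))); last by move=> t /step[].
rewrite wper addbb addbF.
have -> : \big[addb/false]_(t < 2 * k) (b && (t < l)) = false.
  have [n ln] : exists n, 2 * k = l + n by exists (2 * m); lia.
  have sub n' : n' <= l -> \big[addb/false]_(t < n') (b && (t < l)) = b && odd n'.
    elim: n' => [|n' IH] h; first by rewrite big_ord0 andbF.
    by rewrite big_ord_recr /= IH ?h 1?ltnW //; case: b; case: odd.
  rewrite ln big_split_ord /= sub // big1 ?addbF; first by rewrite /l mul2n odd_double andbF.
  by move=> t _; rewrite ltnNge leq_addr andbF.
(* Off [u], levels separate all vertices except pairs at equal height on the two branches; if such a
   pair coincided, so would the ancestors m - 1 levels up. *)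
move=> H; suff : false by []; apply: H => a a' aa' a'k E; have := congr1 lev E.
case: (leqP a' l) => a'l.
  by rewrite !w1 in E => //; [move=> _; apply: uinj | lia].
case: (leqP a l) => al.
  rewrite w1 //; have := ulev a al; case: (leqP a' (l + m)) => a'm.
    rewrite lev2; lia.
  rewrite lev3; lia.
case: (leqP a (l + m)) => am; case: (leqP a' (l + m)) => a'm.
- rewrite !lev2; lia.
- rewrite lev2 ?lev3; try lia; move=> aE; case: ancm1.
  have aa : a - l = 2 * k - a' by lia.
  rewrite w2 ?w3 ?aa in E; try lia.
  rewrite (_ : m.-1 = (m.-1 - (2 * k - a')) + (2 * k - a')); last by lia.
  by rewrite !iterD E.
- lia.
- rewrite !lev3; lia.
Qed.

Variable Y : pred T.
Hypothesis Y_lev : forall x, Y x -> lev x = i.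

(* Either the theta is bipartite and Y is a colour class contained in level i, or
   it lies within level i and Y contains all of it; in both cases the paths of even
   length that start in Y end in Y. *)
Lemma no_theta_in_level v N r : symmetric g -> theta g v N r -> 2 * k.-1 < N ->
  (forall x y, g x y -> Y x (+) Y y) \/
  (forall x y, g x y -> Y x && Y y) /\ ~~ (~~ odd N && odd r) -> False.
Proof.
move=> g_sym th Nk cases; have [vN vg vinj vr rN] := th.
pose S := [set x | Y x & [exists j : 'I_N, v (Posz j) == x]].
have memS z : (v z \in S) = Y (v z).
  rewrite inE; case: (Y _) => //=; apply/existsP.
  have lt : `|(z %% Posz N)%Z|%N < N by lia.
  exists (Ordinal lt); apply/eqP => /=.
  by rewrite -(theta_modz z th); congr v; lia.
have inS x : x \in S -> exists2 z, x = v z & Y (v z).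
  by rewrite inE => /andP[Yx /existsP[j /eqP jx]]; exists (Posz j); rewrite ?jx.
have [a0 [a1 [a0S a1S a01]]] : exists a0 a1, [/\ a0 \in S, a1 \in S & a0 != a1].
  have dist (z d : int) : (0 < d < 4)%R -> v z != v (z + d)%R.
    by move=> d0; apply/eqP => /vinj; lia.
  case: cases => [bip | [full _]].
    have [z Yz] : exists z, Y (v z).
      by have := bip _ _ (vg 0); case Y0: (Y (v 0)) => /= Y1; [exists 0%R|exists (0 + 1)%R].
    exists (v z), (v (z + 2)%R); rewrite !memS Yz dist //; split=> //.
    have := bip _ _ (vg z); have := bip _ _ (vg (z + 1)%R); rewrite Yz -addrA.
    by case: (Y (v (z + 1)%R)).
  have /andP[Y0 Y1] := full _ _ (vg 0).
  by exists (v 0), (v (0 + 1)%R); rewrite !memS Y0 Y1 dist.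
have levS x : x \in S -> lev x = i by rewrite inE => /andP[/Y_lev].
(* The least such [m] is the height at which the tree paths from all of [S] have met; it is at most
   [i], where they reach the root. *)
pose P m := [forall x in S, forall y in S, iter m par x == iter m par y].
have PP m : reflect {in S &, forall x y, iter m par x = iter m par y} (P m).
  apply: (iffP forall_inP) => [H x y xS yS | H x xS].
    by have /forall_inP/(_ y yS)/eqP := H x xS.
  by apply/forall_inP => y yS; apply/eqP/H.
have exP : exists m, P m.
  exists i; apply/PP => x y xS yS; apply: root_uniq; rewrite lev_anc ?levS ?subnn //; lia.
case: (ex_minnP exP) => m /PP Pm mmin.
have mi : m <= i.
  by apply: mmin; apply/PP => x y xS yS; apply: root_uniq; rewrite lev_anc ?levS ?subnn //; lia.
have m0 : 0 < m.
  by case: (posnP m) Pm => // -> Pm; case/eqP: a01; apply: Pm.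
have [a [a' [aS a'S aa']]] : exists a a',
    [/\ a \in S, a' \in S & iter m.-1 par a != iter m.-1 par a'].
  have : ~~ P m.-1 by apply/negP => /mmin; lia.
  case/forall_inPn => x xS /forall_inPn[y yS xy]; by exists x, y.
(* The coloured vertices are those of [S] below the same child of the common ancestor as [a]. *)
pose chi x := (x \in S) && (iter m.-1 par x == iter m.-1 par a).
pose l := 2 * (k - m).
have l0 : 0 < l by lia.
have vcl : closed_under_paths g chi l v.
  move=> u up uv /andP[u0S /eqP u0a].
  have Yu : Y (u l).
    have Yu0 : Y (u 0) by move: u0S; rewrite inE => /andP[].
    case: (up) => ug _; case: cases => [bip | [full _]].
      have alt t : t <= l -> Y (u t) = ~~ odd t.
        elim: t => [|t IHt] tl; first by rewrite Yu0.
        by have := bip _ _ (ug t tl); rewrite IHt 1?ltnW //=; case: odd; case: (Y _).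
      by rewrite alt // /l mul2n odd_double.
    by have := full _ _ (ug l.-1 ltac:(lia)); rewrite prednK // => /andP[].
  have ulS : u l \in S by have [z uz] := uv l; rewrite uz memS -uz.
  rewrite /chi ulS -u0a eq_sym; apply/eqP.
  by apply: level_path_ancestor; rewrite ?m0 // ?levS //; apply: Pm.
have [z1 az1 _] := inS a aS; have [z2 az2 Yz2] := inS a' a'S.
have c1 : chi (v z1) by rewrite -az1 /chi aS eqxx.
have c2 : ~~ chi (v z2) by rewrite -az2 /chi a'S eq_sym.
have lN : l < N by lia.
have [Ne ro alt] := theta_colouring g_sym th vcl l0 lN c1 c2.
case: cases => [bip | [_]]; last by rewrite Ne ro.
(* The uncoloured [v z2] lies in [Y], and its successor is coloured, hence also in [Y]: an edge
   inside one class. *)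
have : chi (v (z2 + 1)%R) by rewrite alt.
by case/andP; rewrite memS => Y3 _; have := bip _ _ (vg z2); rewrite Yz2 Y3.
Qed.

End OneLevel.
End LevelStructure.

(** * Breadth-first layers *)

Section Levels.
Variables (T : finType) (e : rel T) (k : nat) (root : T).

Fixpoint ball (i : nat) : {set T} :=
  if i is j.+1 then ball j :|: [set y | [exists x in ball j, e x y]] else [set root].

(* Vertices at distance more than k get the level k.+1. *)
Definition level (x : T) : nat := find (fun i => x \in ball i) (iota 0 k.+1).

Lemma level_le i x : i <= k -> x \in ball i -> level x <= i.
Proof.
move=> ik xi; rewrite leqNgt; apply/negP => lt; have := before_find 0 lt.
by rewrite nth_iota // xi.
Qed.

Lemma level_ball x : level x <= k -> x \in ball (level x).
Proof.
move=> lk; have hs : has (fun i => x \in ball i) (iota 0 k.+1).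
  by rewrite has_find size_iota.
by have := nth_find 0 hs; rewrite nth_iota.
Qed.

Lemma level_root : level root = 0.
Proof. by apply/eqP; rewrite -leqn0 level_le //= set11. Qed.

Lemma level0 x : level x = 0 -> x = root.
Proof. by move=> l0; have := @level_ball x; rewrite l0 /= => /(_ isT) /set1P. Qed.

Lemma level_edge x y : e x y -> level x < k -> level y <= (level x).+1.
Proof.
move=> exy xk; apply: level_le => //=; rewrite !inE; apply/orP; right.
by apply/exists_inP; exists x => //; apply/level_ball/ltnW.
Qed.

Definition parent (x : T) : T := odflt x [pick y | e y x && (level y == (level x).-1)].

Lemma parentP x : 0 < level x <= k -> e (parent x) x /\ level (parent x) = (level x).-1.
Proof.
case/andP=> l0 lk; rewrite /parent; case: pickP => [y /andP[? /eqP]// | no].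
have := level_ball lk; case lx: (level x) l0 lk => [|j] //= _ jk; rewrite !inE.
case/orP=> [xj|/exists_inP[y yj eyx]].
  by have := level_le (ltnW jk) xj; rewrite lx ltnn.
have yle := level_le (ltnW jk) yj.
have := level_edge eyx; rewrite lx => lyx.
by have := no y; rewrite eyx lx /= => /eqP; case; lia.
Qed.

(** Each vertex is switched by the product of the signs on its tree path to the root; the paths of
    [x] and its parent differ in one edge. *)
Lemma tree_switching (sg : T -> T -> bool) : exists sw : T -> bool,
  forall x, 0 < level x <= k -> sg x (parent x) = sw x (+) sw (parent x).
Proof.
exists (fun x => \big[addb/false]_(j < level x) sg (iter j parent x) (iter j.+1 parent x)).
move=> x xk; have [_ pl] := parentP xk.
case lx: (level x) pl xk => [|j] //= pl _; rewrite big_ord_recl /= pl.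
have -> : \big[addb/false]_(i < j) sg (iter i parent (parent x)) (parent (iter i parent (parent x)))
   = \big[addb/false]_(i < j) sg (parent (iter i parent x)) (parent (parent (iter i parent x))).
  by apply: eq_bigr => i _; rewrite -iterSr.
by rewrite addbK.
Qed.
End Levels.

(** Every arc from the independent set [A] ends outside [A], so its reverse is a further arc, not
    counted from [A]. *)
Lemma bipartite_nbhd_sum (T : finType) (g : rel T) (W A : {set T}) :
  symmetric g -> A \subset W -> {in A &, forall x y, ~~ g x y} ->
  (\sum_(x in A) #|nbhd g W x|).*2 <= arcs g W.
Proof.
move=> g_sym AW indep; rewrite (arcs_setD g_sym AW) -addnn -big_split /=.
apply: leq_trans (leq_addl _ _); apply: leq_sum => x xA; rewrite leq_add2l.
apply/subset_leq_card/subsetP => y; rewrite !inE => /andP[yW gxy].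
by rewrite yW gxy !andbT; apply: contraL gxy; apply: indep.
Qed.

(** * Degree sums over the layers *)

Section LevelSizes.
Variables (T : finType) (e : rel T) (k : nat) (lev : T -> nat) (par : T -> T).
Variables (sg : T -> T -> bool) (sw : T -> bool).
Hypotheses (e_sym : symmetric e) (e_irr : irreflexive e).
Hypothesis sg_sym : forall x y, sg x y = sg y x.
Hypothesis root_uniq : forall x y, lev x = 0 -> lev y = 0 -> x = y.
Hypothesis par_edge : forall x, 0 < lev x <= k -> e x (par x).
Hypothesis par_lev : forall x, 0 < lev x <= k -> lev (par x) = (lev x).-1.
Hypothesis par_sign : forall x, 0 < lev x <= k -> sg x (par x) = sw x (+) sw (par x).
Hypothesis lev_edge : forall x y, e x y -> lev x < k -> lev y <= (lev x).+1.
Hypothesis no_positive_cycle : forall w : nat -> T, w (2 * k) = w 0 ->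
  (forall t, t < 2 * k -> e (w t) (w t.+1)) ->
  (forall a b, a <= b -> b < 2 * k -> w a = w b -> a = b) ->
  \big[addb/false]_(t < 2 * k) sg (w t) (w t.+1).
Hypothesis k3 : 2 < k.

Definition layer (i : nat) : {set T} := [set x | lev x == i].

(** Here and in [across], [b] is the sign of the edge after switching. *)
Definition inside (i : nat) (b : bool) : rel T := [rel x y |
  [&& e x y, lev x == i, lev y == i & sg x y == b (+) (sw x (+) sw y)]].

Definition across (i : nat) (b : bool) : rel T := [rel x y |
  [&& e x y, (lev x == i) && (lev y == i.+1) || (lev x == i.+1) && (lev y == i) &
      sg x y == b (+) (sw x (+) sw y)]].

Lemma inside_sym i b : symmetric (inside i b).
Proof.
by move=> x y; rewrite /inside /= e_sym sg_sym (addbC (sw x)); congr andb; rewrite andbCA.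
Qed.

Lemma across_sym i b : symmetric (across i b).
Proof.
by move=> x y; rewrite /across /= e_sym sg_sym (addbC (sw x)) orbC !(andbC (lev _ == i)).
Qed.

Lemma across_no_theta i b v N r : i < k -> theta (across i b) v N r -> 2 * k.-1 < N -> False.
Proof.
move=> ik th Nk.
apply: (@no_theta_in_level _ e k lev par sg sw e_sym sg_sym root_uniq par_edge par_lev par_sign
  no_positive_cycle i b (across i b) ik _ _ _ (fun x => lev x == i) _ v N r) => //.
- by move=> x y /and3P[].
- by move=> x y /and3P[_ _ /eqP].
- by move=> x y /and3P[_ /orP[]/andP[/eqP-> _] _].
- by move=> x /eqP.
- exact: across_sym.
- by left=> x y /and3P[_ /orP[]/andP[/eqP-> /eqP->] _]; rewrite ?eqxx; lia.
Qed.

Lemma inside_no_theta i b v N r : i < k -> theta (inside i b) v N r -> 2 * k.-1 < N -> False.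
Proof.
move=> ik th Nk; have [par_Nr|par_Nr] := boolP (~~ odd N && odd r); last first.
  apply: (@no_theta_in_level _ e k lev par sg sw e_sym sg_sym root_uniq par_edge par_lev par_sign
    no_positive_cycle i b (inside i b) ik _ _ _ (fun x => lev x == i) _ v N r) => //.
  - by move=> x y /and4P[].
  - by move=> x y /and4P[_ _ _ /eqP].
  - by move=> x y /and4P[_ /eqP-> _ _].
  - by move=> x /eqP.
  - exact: inside_sym.
  - by right; split=> // x y /and4P[_ -> -> _].
case/andP: par_Nr => Neven rodd; have [vN vg vinj vr rN] := th.
(* The theta is bipartite, so its even positions serve as the colour class; restricting to edges
   with one end in [Y] keeps the cycle, as [N] is even, and the chord, as [r] is odd. *)
pose Y x := [exists j : 'I_N, ~~ odd j && (v (Posz j) == x)].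
have Yv z : Y (v z) = ((z %% 2)%Z == 0%R).
  have lt : `|(z %% Posz N)%Z|%N < N by lia.
  have jz : v (Posz `|(z %% Posz N)%Z|%N) = v z.
    by rewrite -(theta_modz z th); congr v; lia.
  have odd_mod : ~~ odd `|(z %% Posz N)%Z|%N = ((z %% 2)%Z == 0%R).
    have [n Nn] : exists n, N = 2 * n by exists N./2; lia.
    have := divz_eq z (Posz N); rewrite {2}Nn PoszM mulrCA; lia.
  apply/existsP/idP => [[j /andP[je /eqP vjz]] | z2]; last first.
    by exists (Ordinal lt); rewrite /= odd_mod z2 jz eqxx.
  rewrite -odd_mod (_ : `|_|%N = j) //; rewrite -jz in vjz; have jN := ltn_ord j.
  by case: (leqP j `|(z %% Posz N)%Z|%N) => jl;
     [have := vinj _ _ _ _ vjz | have := vinj _ _ _ _ (esym vjz)]; lia.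
pose g := [rel x y | inside i b x y && (Y x (+) Y y)].
have gsym : symmetric g by move=> x y; rewrite /= -/(inside i b x y) inside_sym addbC.
have th' : theta g v N r.
  split=> //.
  - by move=> z; rewrite /g /= vg !Yv; lia.
  - by rewrite /g /= vr !Yv; lia.
apply: (@no_theta_in_level _ e k lev par sg sw e_sym sg_sym root_uniq par_edge par_lev par_sign
    no_positive_cycle i b g ik _ _ _ (fun x => (lev x == i) && Y x) _ v N r) => //.
- by move=> x y /andP[/and4P[]].
- by move=> x y /andP[/and4P[_ _ _ /eqP]].
- by move=> x y /andP[/and4P[_ /eqP-> _ _]].
- by move=> x /andP[/eqP].
- by left=> x y /andP[/and4P[_ -> -> _]].
Qed.

(** The bound for graphs without long chorded cycles applies with h = k - 1, which exceeds 1 because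
    [2 < k]; bipartiteness halves it for each side. *)
Lemma across_nbhd_sum i b : i < k ->
  \sum_(x in layer i) #|nbhd (across i b) (layer i :|: layer i.+1) x| <=
    k.-1 * (#|layer i| + #|layer i.+1|) /\
  \sum_(x in layer i.+1) #|nbhd (across i b) (layer i :|: layer i.+1) x| <=
    k.-1 * (#|layer i| + #|layer i.+1|).
Proof.
move=> ik; set W := _ :|: _.
have bound : arcs (across i b) W <= (k.-1).*2 * #|W|.
  apply: arcs_no_chorded_cycle.
  - exact: across_sym.
  - by move=> x; rewrite /across /= e_irr.
  - lia.
  - move=> x0 s r hs _; apply/negP => /chorded_cycle_theta th.
    by apply: (across_no_theta ik th); rewrite mul2n.
have cW : #|W| <= #|layer i| + #|layer i.+1| by apply: leq_card_setU.
have half (A : {set T}) : A \subset W -> {in A &, forall x y, ~~ across i b x y} ->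
    \sum_(x in A) #|nbhd (across i b) W x| <= k.-1 * (#|layer i| + #|layer i.+1|).
  move=> AW indep; have := bipartite_nbhd_sum (@across_sym i b) AW indep.
  have := leq_mul (leqnn (k.-1)) cW; rewrite -doubleMl in bound; lia.
split; apply: half; rewrite ?subsetUl ?subsetUr //.
- by move=> x y; rewrite !inE => /eqP xi /eqP yi; rewrite /across /= xi yi; lia.
- by move=> x y; rewrite !inE => /eqP xi /eqP yi; rewrite /across /= xi yi; lia.
Qed.

Lemma inside_nbhd_sum i b : i < k ->
  \sum_(x in layer i) #|nbhd (inside i b) (layer i) x| <= 2 * k.-1 * #|layer i|.
Proof.
move=> ik; rewrite mul2n; apply: (@arcs_no_chorded_cycle _ (inside i b)).
- exact: inside_sym.
- by move=> x; rewrite /inside /= e_irr.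
- lia.
- move=> x0 s r hs _; apply/negP => /chorded_cycle_theta th.
  by apply: (inside_no_theta ik th); rewrite mul2n.
Qed.

(** Neighbours lie in the same or an adjacent layer. With layer sizes a, b, c, each sign contributes
    at most (k-1)(a+b) + 2(k-1)b + (k-1)(b+c) = (k-1)(a+4b+c). *)
Lemma layer_degree_sum i : i.+1 < k ->
  \sum_(x in layer i.+1) #|nbhd e setT x| <=
    2 * k.-1 * (#|layer i| + 4 * #|layer i.+1| + #|layer i.+2|).
Proof.
move=> ik; pose n1 b x := nbhd (inside i.+1 b) (layer i.+1) x.
pose n2 b x := nbhd (across i b) (layer i :|: layer i.+1) x.
pose n3 b x := nbhd (across i.+1 b) (layer i.+1 :|: layer i.+2) x.
have split x : x \in layer i.+1 -> #|nbhd e setT x| <=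
    \sum_(b : bool) (#|n1 b x| + #|n2 b x| + #|n3 b x|).
  rewrite inE => /eqP xi.
  have sub : nbhd e setT x \subset \bigcup_(b : bool) (n1 b x :|: n2 b x :|: n3 b x).
    apply/subsetP => y; rewrite !inE /= => exy; apply/bigcupP.
    exists (sg x y (+) (sw x (+) sw y)) => //.
    rewrite !inE /inside /across /= exy xi addbK !eqxx /= !andbT.
    have := lev_edge exy; have := @lev_edge y x; rewrite e_sym xi => /(_ exy); lia.
  apply: leq_trans (subset_leq_card sub) _; rewrite !big_bool /=.
  apply: leq_trans (leq_card_setU _ _) _; apply: leq_add;
    (apply: leq_trans (leq_card_setU _ _) _; rewrite leq_add2r; exact: leq_card_setU).
apply: leq_trans (leq_sum _ split) _.
rewrite exchange_big big_bool /= !big_split /=.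
have [_ a1] := across_nbhd_sum true (ltnW ik); have [_ a2] := across_nbhd_sum false (ltnW ik).
have [b1 _] := across_nbhd_sum true ik; have [b2 _] := across_nbhd_sum false ik.
have c1 := inside_nbhd_sum true ik; have c2 := inside_nbhd_sum false ik.
rewrite /n1 /n2 /n3; nia.
Qed.
End LevelSizes.

(** * Growth of the layers *)

Local Open Scope ring_scope.

(** Take a minimal set [W] with more than [2 * t * #|W|] arcs: deleting a vertex of degree at most
    [t] would lose at most [2 * t] arcs and leave a smaller such set. *)
Lemma dense_subset_min_degree (R : realFieldType) (T : finType) (e : rel T) (t : R) :
  symmetric e -> irreflexive e -> 2 * t * #|T|%:R < (arcs e setT)%:R ->
  exists2 W : {set T}, W != set0 & forall x, x \in W -> t < #|nbhd e W x|%:R.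
Proof.
move=> e_sym e_irr dense; pose P (W : {set T}) := 2 * t * #|W|%:R < (arcs e W)%:R.
have PT : P setT by rewrite /P cardsT.
have [W mW _] := minset_exists PT.
have PW := minsetp mW; exists W.
  apply: contraTneq PW => ->; rewrite /P /arcs big_set0 cards0; lra.
move=> x xW; rewrite ltNge; apply/negP => small.
have : P (W :\ x).
  move: PW; rewrite /P (arcs_setD1 e_sym e_irr xW) (cardsD1 x W) xW add1n -natr1 natrD -addnn natrD.
  lra.
move=> PWx; have := minsetinf mW PWx (subD1set W x) => E.
by move: xW; rewrite -E !inE eqxx.
Qed.

Lemma signed_arcs_bound (R : realFieldType) (T : finType) (e : rel T) (sg : T -> T -> bool)
    (k : nat) (q : R) :
  symmetric e -> irreflexive e -> (forall x y, sg x y = sg y x) -> (2 < k)%N ->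
  (forall w : nat -> T, w (2 * k)%N = w 0%N ->
    (forall t, (t < 2 * k)%N -> e (w t) (w t.+1)) ->
    (forall a b, (a <= b)%N -> (b < 2 * k)%N -> w a = w b -> a = b) ->
    \big[addb/false]_(t < 2 * k) sg (w t) (w t.+1)) ->
  0 < q -> q ^+ k = #|T|%:R ->
  (arcs e setT)%:R <= 2 * (2 * k.-1%:R * (q + 4 + q^-1)) * #|T|%:R :> R.
Proof.
move=> e_sym e_irr sg_sym k3 noC q0 qk; rewrite leNgt; apply/negP => dense.
have [W W0 deg] := dense_subset_min_degree e_sym e_irr dense.
have [root rW] := set0Pn _ W0.
(* The type [T] is kept and the edges are restricted to [W]; vertices outside [W] are isolated and
   never reached from the root. *)
pose f : rel T := fun x y => [&& e x y, x \in W & y \in W].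
have f_sym : symmetric f by move=> x y; rewrite /f /= e_sym; congr andb; rewrite andbC.
have f_irr : irreflexive f by move=> x; rewrite /f /= e_irr.
pose lev := level f k root; pose par := parent f k root.
have parP x : (0 < lev x <= k)%N -> f (par x) x /\ lev (par x) = (lev x).-1 by exact: parentP.
have [sw swP] := @tree_switching T f k root sg.
have root_uniq x y : lev x = 0%N -> lev y = 0%N -> x = y by move=> /level0 -> /level0 ->.
have par_edge x : (0 < lev x <= k)%N -> f x (par x) by rewrite f_sym => /parP[].
have par_lev x : (0 < lev x <= k)%N -> lev (par x) = (lev x).-1 by case/parP.
have lev_edge x y : f x y -> (lev x < k)%N -> (lev y <= (lev x).+1)%N by exact: level_edge.
have noCf (w : nat -> T) : w (2 * k)%N = w 0%N ->
    (forall t, (t < 2 * k)%N -> f (w t) (w t.+1)) ->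
    (forall a b, (a <= b)%N -> (b < 2 * k)%N -> w a = w b -> a = b) ->
    \big[addb/false]_(t < 2 * k) sg (w t) (w t.+1).
  by move=> w0 fw; apply: noC => // t /fw/and3P[].
have lsum i := @layer_degree_sum T f k lev par sg sw f_sym f_irr sg_sym root_uniq par_edge
  par_lev swP lev_edge noCf k3 i.
have lW x : (lev x <= k)%N -> x \in W.
  case: (posnP (lev x)) => [/level0 -> // | l0 lk].
  by have [|/and3P[]] := parP x; first by rewrite l0.
pose t := 2 * k.-1%:R * (q + 4 + q^-1).
have degf x : x \in W -> t < #|nbhd f setT x|%:R.
  move=> xW; suff -> : nbhd f setT x = nbhd e W x by apply: deg.
  by apply/setP => y; rewrite !inE /f xW /= andbC.
pose n i := #|layer lev i|.
have h0 : 0 < k.-1%:R :> R by rewrite ltr0n; lia.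
have qV0 : 0 < q^-1 by rewrite invr_gt0.
have n0 : n 0%N = 1%N.
  rewrite /n (_ : layer lev 0 = [set root]) ?cards1 //; apply/setP => x; rewrite !inE.
  by apply/eqP/eqP => [/level0 // | ->]; apply: level_root.
have grow i : (i < k)%N -> (0 < n i)%N /\ q * (n i)%:R < (n i.+1)%:R.
  elim: i => [|i IHi] ik.
    (* Layer 1 contains all neighbours of the root, more than [t > q] of them. *)
    rewrite n0 mulr1; split=> //; apply: (@lt_le_trans _ _ t).
      have : 1 <= k.-1%:R :> R by rewrite ler1n; lia.
      rewrite /t; nra.
    apply: ltW; apply: lt_le_trans (degf root rW) _; rewrite ler_nat.
    apply/subset_leq_card/subsetP => y; rewrite !inE /= => fy.
    have := lev_edge _ _ fy; rewrite [lev root]level_root => /(_ ltac:(lia)).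
    rewrite leq_eqVlt ltnS leqn0 => /orP[// | /eqP/level0 yr].
    by move: fy; rewrite yr f_irr.
  have [ni grow] := IHi (ltnW ik).
  have nS : (0 < n i.+1)%N.
    by rewrite -(ltr0n R); apply: lt_trans grow; rewrite mulr_gt0 // ltr0n.
  split=> //.
  have sum : t * (n i.+1)%:R <= \sum_(x in layer lev i.+1) #|nbhd f setT x|%:R.
    rewrite mulr_natr -sumr_const; apply: ler_sum => x; rewrite inE => /eqP lx.
    by apply/ltW/degf/lW; rewrite lx ltnW.
  have := lsum i ik; rewrite -(ler_nat R) natr_sum => /(le_trans sum).
  rewrite !natrM 2!natrD natrM -/(n i) -/(n i.+1) -/(n i.+2) /t -!mulrA !(ler_pM2l (ltr0Sn R 1)).
  rewrite (ler_pM2l h0) => main.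
  (* With this, [main] says (q + 4 + 1/q) n_(i+1) <= n_i + 4 n_(i+1) + n_(i+2), where the terms 4
     n_(i+1) cancel and n_i is absorbed by n_(i+1)/q. *)
  have : (n i)%:R < q^-1 * (n i.+1)%:R by rewrite ltr_pdivlMl.
  lra.
have pow i : (i < k)%N -> q ^+ i.+1 < (n i.+1)%:R.
  elim: i => [|i IHi] ik; have [_] := grow _ ik; first by rewrite n0 mulr1.
  by apply: le_lt_trans; rewrite exprS ler_pM2l // ltW // IHi // ltnW.
have := pow k.-1; rewrite prednK; last by lia.
rewrite qk ltr_nat ltnNge max_card => /(_ ltac:(lia)) //.
Qed.

(** * From signed graphs to relations with boolean signs *)

Section SignedGraph.
Variables (V : finType) (S : signed_graph V).
Let G := underlying S.

Lemma adj_sym : symmetric (adj G).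
Proof. by move=> x y; rewrite /adj /= setUC. Qed.

Lemma edge_card2 (A : {set V}) : A \in edge_set G -> #|A| = 2%N.
Proof. by move=> AG; case: G AG => E /= /forall_inP H /H/eqP. Qed.

Lemma adj_irr : irreflexive (adj G).
Proof. by move=> x; apply/negP => /edge_card2; rewrite setUid cards1. Qed.

(** Count the pairs of an edge and one of its ends: the edges at [x] are images of neighbours [y]
    under [[set x; y]]. *)
Lemma handshake_le : (2 * #|edge_set G| <= arcs (adj G) setT)%N.
Proof.
have -> : (2 * #|edge_set G| = \sum_(A in edge_set G) \sum_(x in A) 1)%N.
  rewrite mulnC -sum_nat_const; apply: eq_bigr => A /edge_card2 <-.
  by rewrite sum1_card.
rewrite (exchange_big_dep predT) //= /arcs [leqRHS]big_mkcond; apply: leq_sum => x _.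
rewrite in_setT sum1_card.
apply: leq_trans (leq_imset_card (fun y => [set x; y]) _).
apply/subset_leq_card/subsetP => A /andP[AG xA].
have /eqP/cards2P[y [z [yz AE]]] := edge_card2 AG.
apply/imsetP; move: xA; rewrite AE !inE => /orP[]/eqP xE.
  by exists z; rewrite ?xE // !inE /adj /= -AE.
by exists y; rewrite ?xE 1?setUC // !inE /adj /= setUC -AE.
Qed.

(** The exponent of -1 in [edge_sign]; the default [false] matches the default sign 1. *)
Definition negative_edge (x y : V) : bool :=
  if insub [set x; y] is Some e then signature S e else false.

Lemma edge_signE x y : edge_sign S x y = (-1) ^+ negative_edge x y.
Proof. by rewrite /edge_sign /negative_edge; case: insub. Qed.

Lemma negative_edgeC x y : negative_edge x y = negative_edge y x.
Proof. by rewrite /negative_edge setUC. Qed.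

(** The sequence [mkseq w l] is a cycle in the sense of [is_cycle], and its sign is -1 to the sum of
    the booleans. *)
Lemma closed_walk_negative (l : nat) (w : nat -> V) : (3 <= l)%N ->
  balanced_cycle_free l S -> w l = w 0%N ->
  (forall t, (t < l)%N -> adj G (w t) (w t.+1)) ->
  (forall a b, (a <= b)%N -> (b < l)%N -> w a = w b -> a = b) ->
  \big[addb/false]_(t < l) negative_edge (w t) (w t.+1).
Proof.
move=> l3 free wl we winj.
have sz : size (mkseq w l) == l by rewrite size_mkseq.
have us : uniq (mkseq w l).
  apply/mkseq_uniqP => a b; rewrite !inE => al bl E.
  by case: (leqP a b) => ab; [apply: winj | apply/esym/winj => //; apply: ltnW].
have nextE t : (t < l)%N -> next (mkseq w l) (w t) = w t.+1.
  move=> tl; have wt : w t \in mkseq w l by apply: map_f; rewrite mem_iota.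
  rewrite next_nth wt; case: l l3 wl tl {wt we winj free sz} us => // l l3 wl tl us.
  have -> : index (w t) (mkseq w l.+1) = t.
    by rewrite -[X in index X _](nth_mkseq (w 0%N) w tl) index_uniq ?size_mkseq.
  rewrite /=; move: tl; rewrite ltnS leq_eqVlt => /predU1P[-> | tl].
    (* After the last vertex [next] falls back on its default, the first vertex [w 0], which equals
       [w l]. *)
    by rewrite nth_default ?wl // size_map size_iota.
  by rewrite (nth_map 0%N) ?size_iota // nth_iota.
have cyc : cycle (adj G) (mkseq w l).
  apply: cycle_from_next => // x /mapP[t]; rewrite mem_iota => /andP[_ tl] ->.
  by rewrite nextE // we.
move/existsPn: free => /(_ (Tuple sz)); rewrite /is_cycle size_mkseq l3 /ucycleb us cyc /=.
rewrite /balanced /cycle_sign /=.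
have -> : \prod_(x <- mkseq w l) edge_sign S x (next (mkseq w l) x) =
    (-1) ^+ nat_of_bool (\big[addb/false]_(t < l) negative_edge (w t) (w t.+1)).
  rewrite big_map -[X in iota _ X](subn0 l) -/(index_iota 0 l) big_mkord.
  have nE (t : 'I_l) : true -> edge_sign S (w t) (next (mkseq w l) (w t)) =
      (-1) ^+ negative_edge (w t) (w t.+1).
    by move=> _; rewrite nextE // edge_signE.
  rewrite (eq_bigr _ nE).
  by elim/big_rec2: _ => // t b y _ ->; rewrite signr_addb.
by case: (\big[_/_]_(_ < _) _).
Qed.
End SignedGraph.

Theorem theorem3p2 (R : realType) (k n : nat) (hk : (3 <= k)%N) (hn : (2 <= n)%N) :
  (signed_ex n (2 * k))%:R
    <= 2 * (k%:R - 1) * n%:R `^ (1 + 1 / k%:R)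
       + 8 * (k%:R - 1) * n%:R
       + 2 * (k%:R - 1) * n%:R `^ (1 - 1 / k%:R) :> R.
Proof.
pose q : R := n%:R `^ (1 / k%:R).
have n0 : (0 : R) < n%:R by rewrite ltr0n; lia.
have q0 : 0 < q by rewrite powR_gt0.
have k0 : k%:R != 0 :> R by rewrite pnatr_eq0; lia.
have qk : q ^+ k = n%:R by rewrite -powR_mulrn ?ltW // -powRrM divfK // powRr1 // ltW.
have kE : k%:R - 1 = k.-1%:R :> R by rewrite -subn1 natrB //; lia.
have h0 : 0 <= k.-1%:R :> R by rewrite ler0n.
(* The powers of n become n q and n / q, so the claim reads 2(k-1)(q + 4 + 1/q) n. *)
rewrite !powRD ?(gt_eqF n0) ?implybT // powRN -/q powRr1 ?(ltW n0) // kE.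
have qV0 : 0 < q^-1 by rewrite invr_gt0.
rewrite /signed_ex; elim/big_ind: _ => [|x y hx hy|S free].
- by rewrite !addr_ge0 ?mulr_ge0 ?(ltW n0) ?(ltW q0) ?(ltW qV0) ?ler0n.
- by rewrite /maxn; case: ifP.
have bound := @signed_arcs_bound R _ (adj (underlying S)) (@negative_edge _ S) k q
  (@adj_sym _ S) (@adj_irr _ S) (@negative_edgeC _ S) hk.
have := bound _ q0; rewrite card_ord qk => /(_ _ erefl) {}bound.
have := handshake_le S; rewrite -(ler_nat R) natrM => hs.
have : (arcs (adj (underlying S)) setT)%:R <= 2 * (2 * k.-1%:R * (q + 4 + q^-1)) * n%:R :> R.
  by apply: bound => w; apply: closed_walk_negative => //; lia.
lra.
Qed.
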